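(* Let $k\ge 1$ and $n\ge 1$ be integers. For the weaving knot $W(2k+1,n)$ the signature is $\sigma(W(2k+1,n))=0$, and for the weaving knot $W(2k,n)$ the signature is $\sigma(W(2k,n))=-n+1$.
   Context: For $p\ge 2$ and $n\ge 1$, the weaving knot (or link) $W(p,n)$ is the closure of the braid $(\sigma_1\sigma_2^{-1}\sigma_3\sigma_4^{-1}\cdots\sigma_{p-1}^{\pm1})^n$ on $p$ strands, the exponents alternating in sign starting with $+1$ on $\sigma_1$, with all strands oriented in the same direction along the braid. It has $\gcd(p,n)$ components (so it is a knot when $\gcd(p,n)=1$). The convention is that the generators $\sigma_i$ give positive crossings in the closed braid and the $\sigma_i^{-1}$ give negative crossings. The signature $\sigma(L)$ is the classical signature of the oriented link $L$, with the sign convention under which the positive (right-handed) trefoil has signature $-2$. Equivalently, for a reduced alternating diagram $D$ of an oriented non-split alternating link $L$, $\sigma(L)=o(D)-y(D)-1$, where $y(D)$ is the number of positive crossings and $o(D)$ is the number of components of the diagram obtained by $A$-smoothing every crossing (the $A$-smoothing joins the two regions swept out when the upper strand is rotated counter-clockwise toward the lower strand). *)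

(* Defs.v *)
From mathcomp Require Import all_boot all_order all_algebra all_field.

Set Implicit Arguments.
Unset Strict Implicit.
Unset Printing Implicit Defensive.

Import Order.TTheory GRing.Theory Num.Theory.
Local Open Scope ring_scope.

(* An oriented link is presented as the closure of a braid on p strands, all
   strands being oriented along the braid. The letter (i, true) stands for
   sigma_(i+1), which gives a positive crossing of the closure, and (i, false)
   for its inverse, which gives a negative crossing. *)
Definition braid_word (p : nat) := seq ('I_p.-1 * bool).

(* Generators are numbered from 0 here, so sigma_1, sigma_3, ... have even
   index and occur with exponent +1. *)
Definition weaving (p n : nat) : braid_word p :=
  flatten (nseq n [seq (i, ~~ odd i) | i : 'I_p.-1]).

(* Seifert's algorithm applied to the closure of w gives parallel disks
   D_0, ..., D_(p-1), stacked upwards along the braid axis, and for each letter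
   (i, e) of w a half-twisted band joining D_i to D_(i+1); the bands occur
   around the axis in the order of the letters. This surface is connected when
   each generator occurs in w. *)
Section SeifertMatrix.
Variables (p : nat) (w : braid_word p).

Local Notation crossing := 'I_(size w).
Definition column (c : crossing) : 'I_p.-1 := (tnth (in_tuple w) c).1.
Definition crossing_sign (c : crossing) : int :=
  if (tnth (in_tuple w) c).2 then 1 else -1.

(* A basis of the first homology of the surface: the pair (a, b) of successive
   crossings of column i is the loop that climbs from D_i to D_(i+1) through
   the band a and comes down through the band b. *)
Definition loops : {set crossing * crossing} :=
  [set x : crossing * crossing | [&& (x.1 < x.2)%N, column x.1 == column x.2 &
     [forall c : crossing, (x.1 < c < x.2)%N ==> (column c != column x.1)]]].

(* The linking number of x with the push-off of y to the positive (upper) side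
   of the surface.
   - A loop through bands of signs e and e' has self-linking -(e + e')/2.
   - Two loops of one column that share a band b have intersection number +-1,
     and their two linking numbers add up to the sign of b.
   - If x lies in the column just above that of y, then on their common disk
     the push-off of y passes over x, whence +-1 when the ends of x and y
     alternate around that disk. If x lies in the column just below that of y,
     the push-off of y is entirely above x, whence 0. *)
Definition seifert_linking (x y : crossing * crossing) : int :=
  let: (a, b) := x in
  let: (c, d) := y in
  if column a == column c then
    if x == y then
      if crossing_sign a == crossing_sign b then - crossing_sign a else 0
    else if b == c then
      if crossing_sign b == 1 then 0 else -1
    else if a == d then
      if crossing_sign a == 1 then 1 else 0
    else 0
  else if column a == (column c).+1 :> nat then
    if [&& c < a, a < d & d < b]%N then -1
    else if [&& a < c, c < b & b < d]%N then 1
    else 0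
  else 0.

Definition seifert_matrix : 'M[int]_#|loops| :=
  \matrix_(i, j) seifert_linking (enum_val i) (enum_val j).

End SeifertMatrix.

(* Eigenvalues, repeated according to their algebraic multiplicity. *)
Definition eigenvalues (m : nat) (A : 'M[algC]_m) : seq algC :=
  sval (closed_field_poly_normal (char_poly A)).

(* For symmetric integer matrices, whose eigenvalues are real; in algC the
   comparisons 0 < z and z < 0 hold only for real z. *)
Definition matrix_signature (m : nat) (A : 'M[int]_m) : int :=
  let s := eigenvalues (map_mx intr A) in
  (count (fun z => 0 < z) s)%:Z - (count (fun z => z < 0) s)%:Z.

(* Signature of the closure of w. With these conventions the closure of
   sigma_1 ^ 3, the positive trefoil, has symmetrized Seifert matrix
   [[-2, 1], [1, -2]] and signature -2. *)
Definition link_signature (p : nat) (w : braid_word p) : int :=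
  matrix_signature (seifert_matrix w + (seifert_matrix w)^T).

(* Main.v *)
Require Import Defs.
From mathcomp Require Import all_boot all_order all_algebra all_field.
From mathcomp Require Import ring zify.

(* Loops around distinct even columns are unlinked, so the symmetrized Seifert
   form restricted to the span of the loops around even columns is minus the
   Gram form of their boundary vectors (first band minus last band), which is
   negative definite; on the span of the loops around odd columns it is,
   likewise, positive definite. The two spans are complementary, so the inertia
   of the form is the pair of their dimensions and the linking between adjacent
   columns is irrelevant. Hence each loop contributes minus the sign of its
   column, and W(p, n) has n - 1 loops in each of its p - 1 columns. *)

Set Implicit Arguments.
Unset Strict Implicit.
Unset Printing Implicit Defensive.

Import Order.TTheory GRing.Theory Num.Theory.
Local Open Scope ring_scope.
Local Open Scope sesquilinear_scope.

(** * Eigenvalue counts and inertia of Hermitian forms *)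

Lemma char_poly_conj (F : fieldType) (n : nat) (P A : 'M[F]_n) :
  P \in unitmx -> char_poly (invmx P *m A *m P) = char_poly A.
Proof.
move=> Pu; pose C (M : 'M[F]_n) : 'M[{poly F}]_n := map_mx polyC M.
have CM M N : C (M *m N) = C M *m C N by rewrite /C map_mxM.
have CV : C (invmx P) *m C P = 1%:M by rewrite -CM mulVmx // /C map_mx1.
rewrite /char_poly.
have -> : char_poly_mx (invmx P *m A *m P) = C (invmx P) *m char_poly_mx A *m C P.
  rewrite /char_poly_mx -/(C _) -/(C A) !CM mulmxBr mulmxBl; congr (_ - _).
  by rewrite mul_mx_scalar -scalemxAl CV scalemx1.
by rewrite !det_mulmx mulrAC -det_mulmx CV det1 mul1r.
Qed.

Lemma eigenvalues_conj_diag (n : nat) (P A : 'M[algC]_n) (d : 'rV[algC]_n) :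
    P \in unitmx -> A = invmx P *m diag_mx d *m P ->
  perm_eq (eigenvalues A) [seq d 0 i | i <- enum 'I_n].
Proof.
move=> Pu AE; apply: prod_XsubC_eq.
have := svalP (closed_field_poly_normal (char_poly A)).
rewrite -/(eigenvalues A) (_ : lead_coef _ = 1) ?scale1r => [<-|]; last first.
  exact/monicP/char_poly_monic.
rewrite {1}AE char_poly_conj // char_poly_trig ?diag_mx_is_trig //.
by rewrite big_map big_enum; apply: eq_bigr => i _; rewrite !mxE eqxx.
Qed.

(* The conditions are n - #|P| + n - #|S| < n linear equations on v. *)
Lemma exists_supported (F : fieldType) (n : nat) (Q : 'M[F]_n) (P S : pred 'I_n) :
    (n < #|P| + #|S|)%N ->
  exists v : 'rV[F]_n, [/\ v != 0, forall i, ~~ P i -> v 0 i = 0 &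
                           forall i, ~~ S i -> (v *m Q) 0 i = 0].
Proof.
move=> ltn; pose K := row_mx (colsub (@enum_val _ (predC P)) 1%:M)
                             (colsub (@enum_val _ (predC S)) Q).
have: kermx K != 0.
  rewrite kermx_eq0 -row_leq_rank -ltnNge.
  apply: leq_ltn_trans (rank_leq_col K) _.
  have := cardC P; have := cardC S; rewrite card_ord => eS eP.
  by rewrite -(ltn_add2l (#|P| + #|S|)) addnACA eS eP ltn_add2r.
case/rowV0Pn => v /sub_kermxP vK v0; exists v; split=> //.
- move=> i Pi; have iP : i \in predC P by [].
  have /rowP/(_ (lshift _ (enum_rank_in iP i))) := vK.
  by rewrite mul_mx_row row_mxEl mulmx_colsub mulmx1 !mxE enum_rankK_in.
- move=> i Si; have iS : i \in predC S by [].
  have /rowP/(_ (rshift _ (enum_rank_in iS i))) := vK.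
  by rewrite mul_mx_row row_mxEr mulmx_colsub [LHS]mxE [RHS]mxE enum_rankK_in.
Qed.

Definition hform (n : nat) (A : 'M[algC]_n) (v : 'rV[algC]_n) : algC :=
  (v *m A *m v ^t*) 0 0.

(** Sylvester's law of inertia. A subspace on which the form is definite has dimension at most the
    number of eigenvalues of that sign; the two subspaces have dimensions adding up to [n], so both
    bounds are equalities, whatever the off-diagonal blocks are. *)
Lemma matrix_signature_split (n : nat) (A : 'M[int]_n) (P : pred 'I_n) :
    A^T = A ->
    (forall v : 'rV[algC]_n, v != 0 -> (forall i, ~~ P i -> v 0 i = 0) ->
       hform (map_mx intr A) v < 0) ->
    (forall v : 'rV[algC]_n, v != 0 -> (forall i, P i -> v 0 i = 0) ->
       0 < hform (map_mx intr A) v) ->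
  matrix_signature A = #|predC P|%:Z - #|P|%:Z.
Proof.
move=> symA Pneg Ppos; set B := map_mx intr A in Pneg Ppos.
have hermB : B \is hermsymmx.
  apply/is_hermitianmxP; rewrite expr0 scale1r.
  by apply/matrixP => i j; rewrite !mxE rmorph_int -[in LHS]symA mxE.
have realD := hermitian_spectral_diag_real hermB.
have /orthomx_spectralP BE := hermitian_normalmx hermB.
have unitaryQ := spectral_unitarymx B; have unitQ := spectral_unit B.
set Q := spectralmx B in BE unitaryQ unitQ; set d := spectral_diag B in BE realD.
have hformE v : hform B v = \sum_i d 0 i * `|(v *m Q ^t*) 0 i| ^+ 2.
  rewrite /hform {1}BE invmx_unitary // !mulmxA -(mulmxA _ Q).
  have -> : Q *m v ^t* = (v *m Q ^t*) ^t* by rewrite trmx_mul map_mxM trmxCK.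
  rewrite mul_mx_diag mxE; apply: eq_bigr => i _.
  by rewrite !mxE normCK mulrCA -!mulrA mulrCA.
have dreal i : d 0 i \is Num.real by exact: (mxOverP realD).
(* Taking [e] to be 1 or -1 covers both signs. If [R] were larger than [S], some nonzero vector
   supported on [R] would have vanishing spectral coordinates on [S], and [e * hform B] would be at
   most 0 there. *)
have half (e : algC) (R : pred 'I_n) (S := [pred i | 0 < e * d 0 i]) :
    e \is Num.real ->
    (forall v : 'rV_n, v != 0 -> (forall i, ~~ R i -> v 0 i = 0) -> 0 < e * hform B v) ->
  (#|R| <= #|S|)%N.
  move=> e_real posR; rewrite leqNgt; apply/negP => lt.
  have [|v [v0 vR vS]] := @exists_supported _ _ (Q ^t*) R (predC S).
    by rewrite -[ltnLHS]card_ord -(cardC S) ltn_add2r.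
  have := posR v v0 vR; rewrite hformE mulr_sumr le_gtF // sumr_le0 // => i _.
  have [Si|] := boolP (S i); first by rewrite vS ?negbK // normr0 expr0n !mulr0.
  rewrite mulrA inE /= -real_leNgt ?real0 ?realM // => le0.
  by rewrite mulr_le0_ge0 ?exprn_ge0.
pose pos := [pred i | 0 < d 0 i]; pose neg := [pred i | d 0 i < 0].
have le_neg : (#|P| <= #|neg|)%N.
  rewrite (_ : #|neg| = #|[pred i | 0 < -1 * d 0 i]|); last first.
    by apply: eq_card => i; rewrite !inE mulN1r oppr_gt0.
  apply: half => [|v v0 vP]; first by rewrite realN real1.
  by rewrite mulN1r oppr_gt0 Pneg.
have le_pos : (#|predC P| <= #|pos|)%N.
  rewrite (_ : #|pos| = #|[pred i | 0 < 1 * d 0 i]|); last first.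
    by apply: eq_card => i; rewrite !inE mul1r.
  apply: half => // v v0 vP; rewrite mul1r Ppos // => i Pi.
  by rewrite vP //= negbK.
have le_sum : (#|pos| + #|neg| <= n)%N.
  rewrite -[leqRHS]card_ord -(cardC pos) leq_add2l.
  by apply/subset_leq_card/subsetP => i; rewrite !inE => /lt_gtF ->.
rewrite /matrix_signature -/B.
have /permP cs := eigenvalues_conj_diag unitQ BE.
have countE (a : pred algC) :
    count a (eigenvalues B) = #|[pred i | a (d 0 i)]|.
  rewrite cs count_map -sum1_count -sum1_card big_enum_cond.
  by apply: eq_bigl => i; rewrite inE.
rewrite !countE -/pos -/neg.
have := cardC P; rewrite card_ord => eqn.
have le_pos' : (#|pos| + #|neg| <= #|predC P| + #|P|)%N by rewrite [leqRHS]addnC eqn.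
have -> : #|pos| = #|predC P|.
  apply/eqP; rewrite eqn_leq le_pos andbT -(leq_add2r #|P|).
  by apply: leq_trans le_pos'; rewrite leq_add2l.
have -> // : #|neg| = #|P|.
apply/eqP; rewrite eqn_leq le_neg andbT -(leq_add2l #|predC P|).
by apply: leq_trans le_pos'; rewrite leq_add2r.
Qed.

(** * The symmetrized Seifert form when the sign of a crossing is given by the parity of its
    column *)

Section AlternatingBraid.
Variables (p : nat) (w : braid_word p).
Local Notation crossing := 'I_(size w).
Implicit Types x y : crossing * crossing.

Lemma loops_inj1 x y : x \in loops w -> y \in loops w -> x.1 = y.1 -> x = y.
Proof.
case: x y => [a b] [a' b'] /[!inE] /= /and3P[ab /eqP cab /forallP Fb].
move=> /and3P[ab' /eqP cab' /forallP Fb'] eqa.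
move: Fb' ab' cab'; rewrite -{}eqa => Fb' ab' cab'.
congr pair; apply/val_inj; case: (ltngtP b b') => // lt.
- by have := Fb' b; rewrite ab lt /= cab eqxx.
- by have := Fb b'; rewrite ab' lt /= cab' eqxx.
Qed.

Lemma loops_inj2 x y : x \in loops w -> y \in loops w -> x.2 = y.2 -> x = y.
Proof.
case: x y => [a b] [a' b'] /[!inE] /= /and3P[ab /eqP cab /forallP Fb].
move=> /and3P[ab' /eqP cab' /forallP Fb'] eqb.
move: Fb' ab' cab'; rewrite -{}eqb => Fb' ab' cab'.
congr pair; apply/val_inj; case: (ltngtP a a') => // lt.
- by have := Fb a'; rewrite ab' lt /= cab cab' eqxx.
- by have := Fb' a; rewrite ab lt /= cab cab' eqxx.
Qed.

(** For a loop, the signed number of times that it climbs the band [c]. *)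
Definition boundary_coef x (c : crossing) : int :=
  (x.1 == c)%:R - (x.2 == c)%:R.

Lemma boundary_gram x y :
  \sum_c boundary_coef x c * boundary_coef y c =
    (x.1 == y.1)%:R + (x.2 == y.2)%:R - (x.1 == y.2)%:R - (x.2 == y.1)%:R.
Proof.
have delta (a b : crossing) : \sum_c (a == c)%:R * (b == c)%:R = (a == b)%:R :> int.
  rewrite (bigD1 a) //= eqxx mul1r big1 ?addr0 => [|c].
    by rewrite eq_sym.
  by rewrite eq_sym => /negPf->; rewrite mul0r.
rewrite -!delta -!sumrN -!big_split /=; apply: eq_bigr => c _.
by rewrite /boundary_coef; ring.
Qed.

Hypothesis alternating :
  forall c : crossing, crossing_sign c = (-1) ^+ odd (column c).

(** Within one column all bands have the same sign e. A loop gives -2e against a Gram entry 2, and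
    two loops sharing a band give e against a Gram entry -1. Distinct columns of equal parity are
    never adjacent, so there both sides vanish. *)
Lemma seifert_sym_boundary x y :
    x \in loops w -> y \in loops w -> odd (column x.1) = odd (column y.1) ->
  seifert_linking x y + seifert_linking y x =
    - crossing_sign x.1 * \sum_c boundary_coef x c * boundary_coef y c.
Proof.
move=> lx ly par; have inj1 := loops_inj1 lx ly; have inj2 := loops_inj2 lx ly.
rewrite boundary_gram.
move: lx ly par inj1 inj2; case: x y => [a b] [c d].
rewrite !inE /= => /and3P[ab /eqP cab _] /and3P[cd /eqP ccd _] par inj1 inj2.
have sgn : crossing_sign b = crossing_sign a by rewrite !alternating cab.
have sgn' : crossing_sign c = crossing_sign a by rewrite !alternating par.
rewrite /seifert_linking; rewrite [column c == _]eq_sym; case: ifPn => [eqc|neqc].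
  rewrite [(c, d) == _]eq_sym; case: ifPn => [/eqP[<- <-]|ne].
    rewrite sgn !eqxx /= -!val_eqE /= (ltn_eqF ab) (gtn_eqF ab) !subr0.
    by ring.
  have {}inj1 : (a == c) = false.
    by apply/negP => /eqP/inj1/eqP; rewrite (negPf ne).
  have {}inj2 : (b == d) = false.
    by apply/negP => /eqP/inj2/eqP; rewrite (negPf ne).
  rewrite inj1 inj2 [d == a]eq_sym [c == b]eq_sym.
  have [ebc|nbc] := eqVneq b c.
    have nad : (a == d) = false.
      by apply/negbTE; rewrite -val_eqE /= ltn_eqF // (ltn_trans ab) // ebc.
    by rewrite nad sgn sgn' alternating; case: odd.
  have [ead|nad] := eqVneq a d.
    by rewrite alternating -ead alternating; case: odd.
  by rewrite [RHS]mulr0 addr0.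
have nsucc (e e' : crossing) : odd (column e) = odd (column e') ->
    (column e == (column e').+1 :> nat) = false.
  by move=> eqo; apply/negbTE/eqP => /(congr1 odd) /=; rewrite eqo; case: odd.
rewrite !nsucc //.
have ncol (e e' : crossing) : column e != column e' -> (e == e') = false.
  by move=> ne; apply/negbTE; apply: contraNneq ne => ->.
by rewrite !ncol -?cab -?ccd // !subr0 mulr0.
Qed.

Definition boundary_mx : 'M[algC]_(#|loops w|, size w) :=
  \matrix_(i, c) (boundary_coef (enum_val i) c)%:~R.

(* The coefficient of v * boundary_mx at the first band of the earliest loop
   met by v only involves that loop. *)
Lemma boundary_mx_free (v : 'rV[algC]_#|loops w|) :
  v != 0 -> exists c, (v *m boundary_mx) 0 c != 0.
Proof.
case/rV0Pn => i0 vi0.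
case: (@arg_minnP _ i0 (fun i => v 0 i != 0) (fun i => (enum_val i).1) vi0).
move=> i vi mini.
exists (enum_val i).1; rewrite mxE (bigD1 i) //= big1 => [|j ji].
  rewrite addr0 mxE /boundary_coef eqxx.
  have := enum_valP i; rewrite inE => /andP[lt _].
  by rewrite -val_eqE /= gtn_eqF // mulr1.
rewrite mxE /boundary_coef.
have -> : ((enum_val j).1 == (enum_val i).1) = false.
  apply: contraNF ji => /eqP/(loops_inj1 (enum_valP j) (enum_valP i)) eji.
  by apply/eqP/enum_val_inj.
(* Another loop can meet this band only as its second one; it then starts strictly earlier, and
   minimality forces its coefficient in [v] to be 0. *)
have [eq2|_] := eqVneq; last by rewrite mulr0.
suff /eqP-> : v 0 j == 0 by rewrite mul0r.
apply/negPn/negP => /mini; apply/negP; rewrite -ltnNge -eq2.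
by have := enum_valP j; rewrite inE => /andP[].
Qed.

Definition odd_loop : pred 'I_#|loops w| := fun i => odd (column (enum_val i).1).

Local Notation symA := (seifert_matrix w + (seifert_matrix w)^T).

(** Only entries between columns of parity [o] survive, and [seifert_sym_boundary] turns these into
    Gram entries with the common sign of those columns. *)
Lemma hform_seifert (o : bool) (v : 'rV[algC]_#|loops w|) :
    (forall i, odd_loop i != o -> v 0 i = 0) ->
  hform (map_mx intr symA) v =
    - (-1) ^+ o * \sum_c `|(v *m boundary_mx) 0 c| ^+ 2.
Proof.
move=> vo.
have -> : \sum_c `|(v *m boundary_mx) 0 c| ^+ 2 =
          hform (boundary_mx *m boundary_mx ^t*) v.
  rewrite /hform mulmxA -mulmxA -map_mxM -trmx_mul mxE.
  by apply: eq_bigr => c _; rewrite !mxE normCK.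
rewrite /hform !mxE mulr_sumr; apply: eq_bigr => j _.
rewrite !mxE !mulr_suml mulr_sumr.
apply: eq_bigr => i _; rewrite !mxE.
have [oi|/vo->] := eqVneq (odd_loop i) o; last by rewrite !mul0r mulr0.
have [oj|/vo->] := eqVneq (odd_loop j) o; last by rewrite conjC0 !mulr0.
rewrite seifert_sym_boundary ?enum_valP //; last by rewrite [LHS]oi -[LHS]oj.
rewrite alternating [odd _]oi rmorphM rmorph_sum /= rmorphN rmorphXn rmorphN1.
rewrite !mulrA; congr (_ * _); rewrite [v 0 i * _]mulrC; congr (_ * _).
by apply: eq_bigr => c _; rewrite !mxE rmorphM /= rmorph_int.
Qed.

Lemma hform_seifert_gt0 (o : bool) (v : 'rV[algC]_#|loops w|) :
    v != 0 -> (forall i, odd_loop i != o -> v 0 i = 0) ->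
  0 < - (-1) ^+ o * hform (map_mx intr symA) v.
Proof.
move=> /boundary_mx_free[c vc] /hform_seifert->.
rewrite mulrA mulrNN -signr_addb addbb mul1r (bigD1 c) //=.
by rewrite ltr_wpDr ?sumr_ge0 ?exprn_gt0 ?normr_gt0 // => i _; rewrite exprn_ge0.
Qed.

Lemma link_signature_alternating :
  link_signature w = - \sum_(x in loops w) crossing_sign x.1.
Proof.
(* The negative definite part is spanned by the loops around even columns, whose crossings are
   positive. *)
rewrite /link_signature (@matrix_signature_split _ _ (predC odd_loop)).
- rewrite -sumrN big_enum_val /=.
  rewrite (bigID odd_loop) /=; congr (_ + _).
    rewrite (eq_bigr (fun=> 1)) => [|i]; last by rewrite alternating /odd_loop => ->.
    rewrite sumr_const -natz; congr _%:R.
    by apply: eq_card => i; rewrite !inE negbK.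
  rewrite (eq_bigr (fun=> -1)) => [|i]; last first.
    by rewrite alternating /odd_loop => /negPf->.
  by rewrite sumr_const mulNrn -natz.
- by rewrite linearD /= trmxK addrC.
- move=> v v0 vP; have := @hform_seifert_gt0 false v v0.
  rewrite mulN1r oppr_gt0; apply => i; rewrite eqbF_neg negbK => oi.
  by apply: vP; rewrite /= negbK.
- move=> v v0 vP; have := @hform_seifert_gt0 true v v0.
  by rewrite opprK mul1r; apply => i; rewrite eqb_id => oi; apply: vP.
Qed.

End AlternatingBraid.

(** * Counting the loops of a weaving link by their first crossings *)

Lemma nth_flatten_nseq (T : Type) (x0 : T) (s : seq T) (n c : nat) :
  (c < n * size s)%N -> nth x0 (flatten (nseq n s)) c = nth x0 s (c %% size s).
Proof.
elim: n c => [|n IH] c; first by rewrite mul0n.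
rewrite mulSn /= nth_cat => lt; case: ltnP => [/modn_small->//|le].
by rewrite IH ?ltn_subLR // -[in RHS](subnK le) modnDr.
Qed.

Section Weaving.
Variables (p n : nat).
Local Notation m := p.-1.
Local Notation w := (weaving p n).

Lemma size_weaving : size w = (n * m)%N.
Proof.
rewrite /weaving size_flatten /shape map_nseq sumn_nseq size_map.
by rewrite -cardE card_ord mulnC.
Qed.

Lemma column_weaving (c : 'I_(size w)) :
  column c = (c %% m)%N :> nat /\ crossing_sign c = (-1) ^+ odd (c %% m).
Proof.
have ltc : (c < n * m)%N by rewrite -size_weaving.
have /andP[_ m0] : (0 < n)%N && (0 < m)%N.
  by rewrite -muln_gt0 (leq_ltn_trans _ ltc).
have ltm : (c %% m < m)%N by rewrite ltn_mod.
suff E : tnth (in_tuple w) c = (Ordinal ltm, ~~ odd (c %% m)).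
  by rewrite /column /crossing_sign E /=; split=> //; case: odd.
pose x0 := (Ordinal m0, true).
rewrite (tnth_nth x0) /= /weaving nth_flatten_nseq size_map -cardE card_ord //.
rewrite (nth_map (Ordinal m0)) -?cardE ?card_ord //.
by rewrite -[(c %% m)%N]/(val (Ordinal ltm)) nth_ord_enum.
Qed.

(** Successive crossings of a column are exactly [m] apart, so a crossing starts a loop unless it
    lies in the last of the [n] periods. *)
Lemma loop_heads_weaving :
  [set x.1 | x in loops w] = [set c : 'I_(size w) | c < n.-1 * m]%N.
Proof.
have colE c : column c = (c %% m)%N :> nat := (column_weaving c).1.
have ltE a : (a < n.-1 * m)%N = (a + m < size w)%N.
  by rewrite size_weaving -[n.-1]subn1 mulnBl mul1n ltn_subRL addnC.
have gap (a b : 'I_(size w)) : (a < b)%N -> column a = column b -> (m <= b - a)%N.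
  move=> ab /(congr1 val) /=; rewrite !colE => /esym/eqP.
  by rewrite eqn_mod_dvd ?(ltnW ab) // => /dvdn_leq-> //; rewrite subn_gt0.
apply/setP => a; rewrite !inE ltE; apply/imsetP/idP => [[[a' b]]|ltb].
  rewrite inE /= => /and3P[ab /eqP/(gap _ _ ab) le _ ->].
  by apply: leq_ltn_trans (ltn_ord b); rewrite -(subnKC (ltnW ab)) leq_add2l.
have m0 : (0 < m)%N by case: (m) (column a) => [[]|].
exists (a, Ordinal ltb) => //; rewrite inE /=; apply/and3P; split.
- by rewrite -[ltnLHS]addn0 ltn_add2l.
- by rewrite -val_eqE /= !colE /= modnDr.
- apply/forallP => c; apply/implyP => /andP[ac cb].
  apply: contraL cb => /eqP/esym/(gap _ _ ac).
  by rewrite -leqNgt leq_subRL ?(ltnW ac).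
Qed.

(** Signs within a period cancel in pairs, leaving a single +1 exactly when [m] is odd. *)
Lemma sum_weaving_signs (r : nat) :
  \sum_(0 <= c < r * m) (-1) ^+ odd (c %% m) = (odd m)%:Z *+ r.
Proof.
elim: r => [|r IH]; first by rewrite mul0n big_geq.
rewrite mulSnr (big_cat_nat _ (leq_addr _ _)) //= IH mulrS addrC; congr (_ + _).
rewrite -{1}[(r * m)%N]add0n big_addn addKn.
rewrite (eq_big_nat _ _ (F2 := fun i => (-1) ^+ odd i)) => [|i /= ltm]; last first.
  by rewrite addnC modnMDl modn_small.
elim: (m) => [|k IHk]; first by rewrite big_geq.
by rewrite big_nat_recr //= IHk; case: odd.
Qed.

Lemma link_signature_weaving :
  link_signature w = - (odd m)%:Z *+ n.-1.
Proof.
rewrite link_signature_alternating => [|c]; last first.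
  by have [-> ->] := column_weaving c.
(* A loop is determined by its first crossing, so the sum over loops becomes a sum over the first
   [n.-1] periods. *)
rewrite -(big_imset (fun c => crossing_sign c)) /=; last first.
  by move=> x y lx ly; apply: loops_inj1.
rewrite loop_heads_weaving mulNrn -sum_weaving_signs; congr (- _).
rewrite big_mkord (big_ord_widen (size w) (fun c => (-1) ^+ odd (c %% m))); last first.
  by rewrite size_weaving leq_mul2r leq_pred orbT.
by apply: eq_big => [c|c _]; rewrite ?inE //; have [] := column_weaving c.
Qed.

End Weaving.

Theorem proposition2p4 (k n : nat) (hk : (1 <= k)%N) (hn : (1 <= n)%N) :
  link_signature (weaving (2 * k + 1) n) = 0 /\
  link_signature (weaving (2 * k) n) = - n%:Z + 1.
Proof.
rewrite !link_signature_weaving; split.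
  by rewrite addn1 /= oddM mulNrn mul0rn oppr0.
(* Here [k >= 1] matters: for [k = 0] the predecessor truncates to 0, which is even. Likewise
   [n >= 1] makes [n.-1] equal to n - 1 below. *)
have -> : odd (2 * k).-1 by lia.
by rewrite mulNrn natz; lia.
Qed.
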